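(* Let $G$ be a multigraph with maximum degree at most $3$, with $n$ vertices, exactly $c$ cut-edges, and $1$-deficit $d=3n-2|E(G)|$. Then $$f_2(G)\ge n-\max\left\{0,\tfrac{d+c-1}{2}\right\}.$$ Moreover, this bound is sharp: there exist such multigraphs with arbitrarily many vertices for which equality holds.
   Context: Multigraphs are finite and may have loops and multiple edges; a loop contributes $2$ to the degree of its vertex, so the degree-sum is $2|E(G)|$. The $1$-deficit of an $n$-vertex multigraph $G$ of maximum degree at most $3$ is $3n-2|E(G)|$. A cut-edge is an edge whose deletion increases the number of connected components. A subgraph is $2$-regular if every vertex of it has degree $2$ in it. $f_2(G)$ denotes the maximum number of vertices in a $2$-regular subgraph of $G$ (taken to be $0$ if none exists). *)

(* Defs.v *)
From HB Require Import structures.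
From mathcomp Require Import all_boot all_order all_algebra.

Set Implicit Arguments.
Unset Strict Implicit.
Unset Printing Implicit Defensive.

Import Order.TTheory GRing.Theory Num.Theory.

(* The order of the two components of [ends e] carries no meaning: every notion
   below is invariant under swapping them. A loop is an edge with equal ends. *)
Record multigraph := Multigraph {
  vert : finType;
  edge : finType;
  ends : edge -> vert * vert
}.

Section MultigraphNotions.
Variable G : multigraph.
Implicit Types (e : edge G) (v : vert G) (F : {set edge G}).

Definition deg_in F v : nat :=
  \sum_(e in F) (((ends e).1 == v) + ((ends e).2 == v)).

Definition max_degree : nat := \max_v deg_in setT v.

Definition adj_in F : rel (vert G) :=
  fun u v => [exists e in F, (ends e == (u, v)) || (ends e == (v, u))].

(* Number of connected components of the spanning subgraph with edge set F. *)
Definition ncomp F : nat := n_comp (adj_in F) predT.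

Definition cut_edge e : bool := ncomp setT < ncomp [set~ e].

Definition num_cut_edges : nat := #|[set e | cut_edge e]|.

Definition deficit : int := (3 * #|vert G|%:Z - 2 * #|edge G|%:Z)%R.

Definition subgraph (H : {set vert G} * {set edge G}) : bool :=
  [forall e in H.2, ((ends e).1 \in H.1) && ((ends e).2 \in H.1)].

Definition two_regular (H : {set vert G} * {set edge G}) : bool :=
  [forall v in H.1, deg_in H.2 v == 2].

Definition f2 : nat := \max_(H | subgraph H && two_regular H) #|H.1|.

End MultigraphNotions.

(* Main.v *)
Require Import Defs.
From HB Require Import structures.
From mathcomp Require Import all_boot all_order all_algebra.
From mathcomp Require Import zify lra.

(** In a multigraph of maximum degree at most 3, the 2-regular subgraphs are
    the even edge sets (all degrees even), and such a set has as many edges as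
    covered vertices.  A maximum even subset C of a bridgeless edge set S is the
    complement of a minimum T-join, where T is the set of vertices of odd degree
    in S, and all T-cuts of S have at least 3 edges; packing T-cuts as in
    Seymour's theorem gives [3 |S :\: C| <= |S|].
    Even sets avoid cut-edges.  Delete the cut-edges and apply this inequality
    to a component K of what remains: at most [d_K / 3] vertices of K are
    uncovered, where d_K is the deficit of K, and this is at most
    [(d_K - 1) / 2] if d_K > 0.  Sum over the components: the d_K add up to
    d + 2c, and if some d_K is positive then at least c + 1 of them are, because
    the cut-edges form a forest on the components of positive deficit. *)

Set Implicit Arguments.
Unset Strict Implicit.
Unset Printing Implicit Defensive.

Import Order.TTheory GRing.Theory Num.Theory.

Section SymmetricDifference.
Variable T : finType.
Implicit Types A B C D : {set T}.

Definition setY A B : {set T} := [set x | (x \in A) (+) (x \in B)].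

Local Notation "A :+: B" := (setY A B) (at level 52, left associativity).

Lemma in_setY A B x : (x \in A :+: B) = (x \in A) (+) (x \in B).
Proof. by rewrite inE. Qed.

Lemma setYC : commutative setY.
Proof. by move=> A B; apply/setP=> x; rewrite !in_setY addbC. Qed.

Lemma setYA : associative setY.
Proof. by move=> A B C; apply/setP=> x; rewrite !in_setY addbA. Qed.

Lemma setYAC : right_commutative setY.
Proof. by move=> A B C; rewrite -!setYA (setYC B). Qed.

Lemma set0Y : left_id set0 setY.
Proof. by move=> A; apply/setP=> x; rewrite in_setY in_set0. Qed.

Lemma setY0 : right_id set0 setY.
Proof. by move=> A; rewrite setYC set0Y. Qed.

Lemma setYv A : A :+: A = set0.
Proof. by apply/setP=> x; rewrite in_setY addbb in_set0. Qed.

Lemma setYK B A : A :+: B :+: B = A.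
Proof. by rewrite -setYA setYv setY0. Qed.

Lemma setYKA C A B : (A :+: C) :+: (C :+: B) = A :+: B.
Proof. by rewrite setYA setYK. Qed.

Lemma setIYl : left_distributive (@setI T) setY.
Proof.
by move=> A B C; apply/setP=> x; rewrite !(in_setI, in_setY) andb_addl.
Qed.

Lemma subYset A B C : A \subset C -> B \subset C -> A :+: B \subset C.
Proof.
move=> /subsetP sAC /subsetP sBC; apply/subsetP=> x; rewrite in_setY.
by case: (boolP (x \in A)) => [/sAC-> | _ /sBC].
Qed.

Lemma sub_setI0 A B C : A \subset B -> B :&: C = set0 -> A :&: C = set0.
Proof. by move=> sAB BC0; apply/eqP; rewrite -subset0 -BC0 setSI. Qed.

Lemma setDI0 A B : (A :\: B) :&: B = set0.
Proof. by rewrite setIDAC setDIl setDv setI0. Qed.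

Lemma setY_sub A B : B \subset A -> A :+: B = A :\: B.
Proof.
move=> /subsetP sBA; apply/setP=> x; rewrite in_setY in_setD.
by have := sBA x; case: (x \in B); case: (x \in A) => // ->.
Qed.

Definition weight (l : T -> nat) A := \sum_(x in A) l x.

Lemma weightE l A : weight l A = \sum_x (x \in A) * l x.
Proof.
by rewrite /weight big_mkcond; apply: eq_bigr => x _; case: (x \in A); lia.
Qed.

Lemma weight_set1 l x : weight l [set x] = l x.
Proof. exact: big_set1. Qed.

Lemma card_weight A : #|A| = weight (fun=> 1) A.
Proof. by rewrite -sum1_card. Qed.

Lemma weightY l A B :
  weight l (A :+: B) + (weight l (A :&: B)).*2 = weight l A + weight l B.
Proof.
rewrite !weightE -addnn -!big_split /=; apply: eq_bigr => x _.
by rewrite in_setY in_setI; case: (x \in A); case: (x \in B); lia.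
Qed.

Lemma odd_weightY l A B :
  odd (weight l (A :+: B)) = odd (weight l A) (+) odd (weight l B).
Proof. by rewrite -oddD -weightY oddD odd_double addbF. Qed.

Lemma cardsY A B : #|A :+: B| + #|A :&: B|.*2 = #|A| + #|B|.
Proof. by rewrite !card_weight weightY. Qed.

Lemma odd_cardsY A B : odd #|A :+: B| = odd #|A| (+) odd #|B|.
Proof. by rewrite -oddD -cardsY oddD odd_double addbF. Qed.

Lemma odd_cardsIY A B C :
  odd #|(A :+: B) :&: C| = odd #|A :&: C| (+) odd #|B :&: C|.
Proof. by rewrite setIYl odd_cardsY. Qed.

Lemma weight_swap l A B D : {in D, forall x, 0 < l x -> x \in A :+: B} ->
  weight l (A :+: D) + weight l (B :+: D) = weight l A + weight l B.
Proof.
move=> lD; rewrite !weightE -!big_split /=; apply: eq_bigr => x _.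
have := lD x; rewrite !in_setY.
case: (x \in D); rewrite ?addbF // => /(_ isT).
by case: (posnP (l x)) => [-> | _ /(_ isT)];
  case: (x \in A); case: (x \in B); lia.
Qed.

Lemma weightY_null l A D : {in D, forall x, l x = 0} ->
  weight l (A :+: D) = weight l A.
Proof.
move=> l0; rewrite !weightE; apply: eq_bigr => x _.
rewrite in_setY; have := l0 x.
by case: (x \in D) => [-> // | _]; rewrite ?addbF ?muln0.
Qed.

Lemma weight_sub1 l A B : {in A :&: B, forall x, 0 < l x} ->
  weight l A = weight (fun x => l x - (x \in B)) A + #|A :&: B|.
Proof.
move=> l_gt0; rewrite card_weight !weightE -big_split; apply: eq_bigr => x _ /=.
have := l_gt0 x; rewrite in_setI.
by case: (x \in A); case: (x \in B); lia.
Qed.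

Lemma odd_sum (P : pred T) (F : T -> nat) :
  odd (\sum_(x | P x) F x) = odd #|[set x | P x & odd (F x)]|.
Proof.
rewrite -sum1dep_card !(big_morph odd oddD (erefl _)) big_mkcondr.
by apply: eq_bigr => x _; case: odd.
Qed.

Lemma odd_cards1I A x : odd #|[set x] :&: A| = (x \in A).
Proof.
case: (boolP (x \in A)) => Ax; first by rewrite (setIidPl _) ?sub1set ?cards1.
by rewrite disjoint_setI0 ?cards0 // disjoints1.
Qed.

End SymmetricDifference.

Notation "A :+: B" := (setY A B) (at level 52, left associativity).

Section JoinsAndCuts.
Variable G : multigraph.
Implicit Types (e f : edge G) (u v x y : vert G) (A B F : {set edge G}).
Implicit Types (X Y : {set vert G}).

(* A is a T-join when [odd_vertices A = T]. *)
Definition odd_vertices A : {set vert G} := [set v | odd (deg_in A v)].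

Definition cut X : {set edge G} :=
  [set e | ((ends e).1 \in X) (+) ((ends e).2 \in X)].

Definition inside A X : {set edge G} :=
  [set e in A | ((ends e).1 \in X) && ((ends e).2 \in X)].

Lemma odd_verticesY A B :
  odd_vertices (A :+: B) = odd_vertices A :+: odd_vertices B.
Proof. by apply/setP=> v; rewrite in_setY !inE; apply: odd_weightY. Qed.

Lemma odd_vertices0 : odd_vertices set0 = set0.
Proof. by apply/setP=> v; rewrite !inE /deg_in big_set0. Qed.

Lemma odd_vertices1 e :
  odd_vertices [set e] = [set (ends e).1] :+: [set (ends e).2].
Proof.
apply/setP=> v; rewrite !inE /deg_in big_set1 oddD !(eq_sym v).
by do 2 case: (_ == v).
Qed.

Lemma cutY X Y : cut (X :+: Y) = cut X :+: cut Y.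
Proof. by apply/setP=> e; rewrite !inE addbACA. Qed.

Lemma sum_deg_in A X :
  \sum_(v in X) deg_in A v = #|A :&: cut X| + (#|inside A X|).*2.
Proof.
rewrite /deg_in exchange_big /=.
have sum_pred1 a : \sum_(v in X) (a == v : nat) = (a \in X).
  rewrite big_mkcond (bigD1 a) //= eqxx big1 ?addn0 => [|v]; first by case: ifP.
  by rewrite eq_sym => /negPf->; case: ifP.
rewrite !card_weight !weightE -addnn -!big_split /= big_mkcond.
apply: eq_bigr => e _; rewrite big_split /= !sum_pred1 !inE.
by case: (e \in A); case: (_ \in X); case: (_ \in X).
Qed.

Lemma odd_card_cut A X : odd #|A :&: cut X| = odd #|odd_vertices A :&: X|.
Proof.
have : odd (\sum_(v in X) deg_in A v) = odd #|A :&: cut X|.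
  by rewrite sum_deg_in oddD odd_double addbF.
rewrite odd_sum => <-; congr (odd #|pred_of_set _|).
by apply/setP=> v; rewrite !inE andbC.
Qed.

Lemma odd_card_cut_join A X x y : odd_vertices A = [set x] :+: [set y] ->
  odd #|A :&: cut X| = (x \in X) (+) (y \in X).
Proof. by rewrite odd_card_cut => ->; rewrite odd_cardsIY !odd_cards1I. Qed.

Lemma mem_cut_join e X x y : odd_vertices [set e] = [set x] :+: [set y] ->
  (e \in cut X) = (x \in X) (+) (y \in X).
Proof. by move/odd_card_cut_join <-; rewrite odd_cards1I. Qed.

Lemma mem_cutP e X : e \in cut X ->
  exists x y,
    [/\ x \notin X, y \in X & odd_vertices [set e] = [set x] :+: [set y]].
Proof.
rewrite inE; have := odd_vertices1 e.
case: (boolP ((ends e).1 \in X)) => /= e1X odd_e e2X.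
  by exists (ends e).2, (ends e).1; rewrite setYC.
by exists (ends e).1, (ends e).2.
Qed.

Lemma even_card_cut A X : odd_vertices A = set0 -> ~~ odd #|A :&: cut X|.
Proof. by rewrite odd_card_cut => ->; rewrite set0I cards0. Qed.

Lemma deg_inS A B v : A \subset B -> deg_in A v <= deg_in B v.
Proof.
by move=> sAB; rewrite [X in _ <= X](big_setID A) /= (setIidPr sAB) leq_addr.
Qed.

Lemma connect_adj_sym F : connect_sym (adj_in F).
Proof.
by apply: sym_connect_sym => u v; apply: eq_existsb => e; rewrite orbC.
Qed.

Lemma adj_in_ends F e : e \in F -> adj_in F (ends e).1 (ends e).2.
Proof.
by move=> Fe; apply/existsP; exists e; rewrite Fe -surjective_pairing eqxx.
Qed.

Lemma connect_adjS A B : A \subset B ->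
  subrel (connect (adj_in A)) (connect (adj_in B)).
Proof.
move=> /subsetP sAB; apply: connect_sub => u v /existsP[e /andP[/sAB Be uv]].
by apply/connect1/existsP; exists e; rewrite Be.
Qed.

Lemma connect_join F x y : connect (adj_in F) x y ->
  exists2 P : {set edge G}, P \subset F & odd_vertices P = [set x] :+: [set y].
Proof.
case/connectP=> p; elim: p x => [|z p IH] x /=.
  by move=> _ ->; exists set0; rewrite ?sub0set // odd_vertices0 setYv.
case/andP=> /existsP[e /andP[Fe xz]] /IH/[apply] -[P sPF joinP].
exists ([set e] :+: P); first by rewrite subYset ?sub1set.
rewrite odd_verticesY joinP odd_vertices1 -(setYKA [set z] [set x]).
by case/orP: xz => /eqP-> //=; rewrite (setYC [set z]).
Qed.

Lemma connect_cut0 F X x y : F :&: cut X = set0 -> connect (adj_in F) x y ->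
  (x \in X) = (y \in X).
Proof.
move=> F_cut /connect_join[P sPF /(odd_card_cut_join X)].
by rewrite (sub_setI0 sPF F_cut) cards0; do 2 case: (_ \in X).
Qed.

Definition component F v : {set vert G} := [set u | connect (adj_in F) v u].

Lemma component_refl F v : v \in component F v.
Proof. by rewrite inE connect0. Qed.

Lemma notin_cut_component F v e : e \in F -> e \notin cut (component F v).
Proof.
move/adj_in_ends/connect1=> e12; rewrite !inE !(connect_adj_sym F v).
by rewrite (same_connect (connect_adj_sym F) e12) addbb.
Qed.

Lemma component_cut F v : F :&: cut (component F v) = set0.
Proof.
apply/eqP; rewrite setI_eq0 disjoint_subset; apply/subsetP=> e.
exact: notin_cut_component.
Qed.

Lemma eq_component F u v : u \in component F v -> component F u = component F v.
Proof.
rewrite inE => vu; apply/setP=> w; rewrite !inE.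
by rewrite (same_connect (connect_adj_sym F) vu).
Qed.

Lemma component_off_cut A X a u : a \notin X ->
  u \in component (A :\: cut X) a -> u \notin X.
Proof.
by move=> aX; rewrite inE => /(connect_cut0 (setDI0 _ _))<-.
Qed.

(* If the component of x is crossed only once, any other crossing edge leads to
   a component containing neither x nor y, which is crossed an even number of
   times. *)
Lemma join_two_crossings_component A X x y :
    odd_vertices A = [set x] :+: [set y] -> x \notin X -> y \in X ->
    1 < #|A :&: cut X| ->
  exists2 a, a \notin X & 1 < #|A :&: cut (component (A :\: cut X) a)|.
Proof.
move=> joinA xX yX crossA; set comp := component _.
have y_comp a : a \notin X -> y \notin comp a.
  by move=> aX; apply: contraL yX; apply: component_off_cut.
have [cross_x | cross_x_le1] := ltnP 1 #|A :&: cut (comp x)|; first by exists x.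
have [f] : exists f, f \in (A :&: cut X) :\: (A :&: cut (comp x)).
  apply/set0Pn; rewrite -card_gt0 -subn_gt0.
  have := cardsID (A :&: cut (comp x)) (A :&: cut X).
  have := subset_leq_card (subsetIr (A :&: cut X) (A :&: cut (comp x))); lia.
rewrite in_setD !in_setI => /andP[fx /andP[Af /mem_cutP[a [b [aX bX f_ab]]]]].
have b_comp c : c \notin X -> b \notin comp c.
  by move=> cX; apply: contraL bX; apply: component_off_cut.
have x_comp : x \notin comp a.
  apply: contra fx => /eq_component; rewrite Af => compE.
  rewrite (mem_cut_join _ f_ab) (negPf (b_comp x xX)) addbF.
  by rewrite /comp compE component_refl.
exists a => //; have f_in : f \in A :&: cut (comp a).
  rewrite in_setI Af (mem_cut_join _ f_ab) component_refl.
  by rewrite (negPf (b_comp a aX)).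
have := odd_card_cut_join (comp a) joinA.
rewrite (negPf x_comp) (negPf (y_comp a aX)) (cardsD1 f) f_in.
by case: #|_|.
Qed.

(* Two edges of A crossing the cut are joined outside the component by edges of
   A, and inside it by edges of F. *)
Lemma join_two_crossings F A x y :
    odd_vertices A = [set x] :+: [set y] -> x \notin component F y ->
    1 < #|A :&: cut (component F y)| ->
  exists D : {set edge G}, [/\ odd_vertices D = set0, D \subset A :|: F &
    #|D :&: cut (component F y)| = 2].
Proof.
set X := component F y => joinA xX crossA.
have yX : y \in X := component_refl F y.
have [a aX] := join_two_crossings_component joinA xX yX crossA.
set A' := A :\: cut X; set W := component A' a => /card_gt1P[f [g [fW gW nfg]]].
have WX u : u \in W -> u \notin X by apply: component_off_cut.
have inner_end e : e \in A :&: cut W -> e \in A :&: cut X /\ exists b c,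
    [/\ b \in W, c \in X & odd_vertices [set e] = [set b] :+: [set c]].
  rewrite !in_setI => /andP[Ae We].
  have Xe : e \in cut X.
    apply: contraTT We => Xe; apply: notin_cut_component.
    by rewrite in_setD Xe.
  rewrite Ae Xe; split=> //; have [b [c [_ cX e_bc]]] := mem_cutP Xe.
  exists b, c; split=> //; move: We; rewrite (mem_cut_join _ e_bc).
  by rewrite (negPf (contraL (@WX c) cX)) addbF.
have [fAX [b [c [bW cX f_bc]]]] := inner_end f fW.
have [gAX [b' [c' [bW' cX' g_bc]]]] := inner_end g gW.
have [P sPA P_bb] : exists2 P : {set edge G}, P \subset A' &
    odd_vertices P = [set b] :+: [set b'].
  move: bW bW'; rewrite !inE => ab /(connect_trans _) ab'.
  by apply/connect_join/ab'; rewrite connect_adj_sym.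
have [Z sZF Z_cc] : exists2 Z : {set edge G}, Z \subset F &
    odd_vertices Z = [set c'] :+: [set c].
  move: cX cX'; rewrite !inE => yc yc'.
  by apply/connect_join/(connect_trans _ yc); rewrite connect_adj_sym.
exists ([set f] :+: P :+: [set g] :+: Z); split.
- rewrite !odd_verticesY f_bc P_bb g_bc Z_cc (setYC [set b] [set c]).
  by rewrite !setYKA setYv.
- move: fAX gAX; rewrite !in_setI => /andP[Af _] /andP[Ag _].
  rewrite !subYset ?sub1set ?in_setU ?Af ?Ag //.
    by apply: subset_trans sPA _; rewrite subDset setUCA subsetUl.
  by apply: subset_trans sZF (subsetUr _ _).
move: fAX gAX; rewrite !in_setI => /andP[_ Xf] /andP[_ Xg].
rewrite !setIYl (sub_setI0 sZF (component_cut F y)) setY0.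
rewrite (sub_setI0 sPA (setDI0 _ _)) setY0 !(setIidPl _) ?sub1set //.
have := cardsY [set f] [set g].
rewrite !cards1 disjoint_setI0 ?cards0 ?addn0 //.
by rewrite disjoints1 inE.
Qed.

End JoinsAndCuts.

Section MinimumJoins.
Variable G : multigraph.
Implicit Types (A B D J Q S Z : {set edge G}) (X Y T : {set vert G}).
Implicit Types (l : edge G -> nat).

Definition min_join l S J := J \subset S /\
  forall A, A \subset S -> odd_vertices A = odd_vertices J ->
    weight l J <= weight l A.

Definition near_join S T A : bool :=
  (A \subset S) &&
  [exists x, [exists y, odd_vertices A == T :+: [set x] :+: [set y]]].

Lemma near_joinI S T A x y : A \subset S ->
  odd_vertices A = T :+: [set x] :+: [set y] -> near_join S T A.
Proof.
move=> sAS oddA; rewrite /near_join sAS.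
by apply/existsP; exists x; apply/existsP; exists y; apply/eqP.
Qed.

Definition null_edges l S : {set edge G} := [set e in S | l e == 0].

Lemma null_edges_sub l S : null_edges l S \subset S.
Proof. by apply/subsetP=> e; rewrite inE => /andP[]. Qed.

Lemma null_edgesP l S Z : Z \subset null_edges l S -> {in Z, forall e, l e = 0}.
Proof. by move/subsetP=> sZ e /sZ; rewrite inE => /andP[_ /eqP]. Qed.

Section NearestJoin.
Variables (l : edge G -> nat) (S : {set edge G}) (T : {set vert G}).
Variables (x t : vert G) (m : nat).
Hypothesis near_join_ge : forall A, near_join S T A -> m <= weight l A.
Let X := component (null_edges l S) t.

Lemma null_component_cut_gt0 e : e \in S -> e \in cut X -> 0 < l e.
Proof.
move=> Se Xe; rewrite lt0n; apply: contraL Xe => le.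
by apply: notin_cut_component; rewrite inE Se.
Qed.

(* An edge of Q crossing the cut could be removed, moving t to its outer end. *)
Lemma nearest_join_disjoint Q : Q \subset S ->
  odd_vertices Q = T :+: [set x] :+: [set t] -> weight l Q <= m ->
  Q :&: cut X = set0.
Proof.
move=> sQS oddQ Qm; apply/eqP/set0Pn => -[f /setIP[Qf Xf]].
have Sf := subsetP sQS f Qf; have l_f := null_component_cut_gt0 Sf Xf.
have [a [b [_ bX f_ab]]] := mem_cutP Xf.
have [Z sZ Z_tb] : exists2 Z : {set edge G}, Z \subset null_edges l S &
    odd_vertices Z = [set t] :+: [set b].
  by move: bX; rewrite inE => /connect_join.
have sZS := subset_trans sZ (null_edges_sub l S).
have /near_join_ge : near_join S T (Q :+: [set f] :+: Z).
  apply: (@near_joinI _ _ _ x a); first by rewrite !subYset ?sub1set.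
  rewrite !odd_verticesY oddQ f_ab Z_tb setYAC setYKA.
  by rewrite (setYC [set a]) setYKA.
rewrite weightY_null; last exact: null_edgesP sZ.
have := weightY l Q [set f]; rewrite (setIidPr _) ?sub1set // weight_set1; lia.
Qed.

Section Exchange.
Variables (Q : {set edge G}) (Y : {set vert G}).
Hypothesis odd_length : {in S, forall e, odd (l e) = (e \in cut Y)}.
Hypothesis sQS : Q \subset S.
Hypothesis Q_xt : odd_vertices Q = T :+: [set x] :+: [set t].
Hypotheses (Q_min : weight l Q = m) (xX : x \notin X).

Let Q_cut : Q :&: cut X = set0.
Proof. by apply: nearest_join_disjoint; rewrite ?Q_min. Qed.

Let joinY A : odd_vertices A = T ->
  odd_vertices (A :+: Q) = [set x] :+: [set t].
Proof.
by move=> oddA; rewrite odd_verticesY Q_xt oddA -setYA setYA setYv set0Y.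
Qed.

Lemma even_weight A : A \subset S -> odd_vertices A = set0 ->
  ~~ odd (weight l A).
Proof.
move=> /subsetP sAS /(even_card_cut Y).
rewrite odd_sum; congr (~~ odd #|pred_of_set _|); apply/setP=> e.
rewrite in_setI [in RHS]in_set.
by case: (boolP (e \in A)) => //= /sAS/odd_length->.
Qed.

(* All crossing edges of A :+: Q belong to A.  Exchanging A and Q along an even
   set D with two crossings makes Q cross the cut, hence not of minimum weight;
   by parity Q gets heavier by at least 2, and A lighter by the same amount. *)
Lemma join_exchange A : A \subset S -> odd_vertices A = T ->
  1 < #|A :&: cut X| ->
  exists B, [/\ B \subset S, odd_vertices B = T,
    #|B :&: cut X| + 2 = #|A :&: cut X| & weight l B + 2 <= weight l A].
Proof.
move=> sAS oddA crossA.
have [|D [evenD sD crossD]] := join_two_crossings (joinY oddA) xX.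
  by rewrite setIYl Q_cut setY0.
have sDS : D \subset S.
  by apply: subset_trans sD _; rewrite subUset subYset ?null_edges_sub.
have D_swap : {in D, forall e, 0 < l e -> e \in A :+: Q}.
  by move=> e /(subsetP sD) /setUP[//|]; rewrite inE => /andP[_ /eqP->].
have sDA : D :&: cut X \subset A :&: cut X.
  apply/subsetP=> e /setIP[De Xe].
  have l_e := null_component_cut_gt0 (subsetP sDS e De) Xe.
  have := D_swap e De l_e; rewrite in_setI Xe andbT in_setY.
  have := in_set0 e; rewrite -Q_cut in_setI Xe andbT => ->.
  by rewrite addbF.
exists (A :+: D); split.
- exact: subYset.
- by rewrite odd_verticesY evenD setY0.
- have := cardsID (D :&: cut X) (A :&: cut X); rewrite (setIidPr sDA) crossD.
  by rewrite setIYl setY_sub // addnC => ->.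
have Q'_xt : odd_vertices (Q :+: D) = T :+: [set x] :+: [set t].
  by rewrite odd_verticesY evenD setY0.
have sQ'S : Q :+: D \subset S by apply: subYset.
have wQ'_ge : m <= weight l (Q :+: D) by apply/near_join_ge/near_joinI/Q'_xt.
have wQ'_neq : weight l (Q :+: D) != m.
  apply/negP=> /eqP Q'_min; have := nearest_join_disjoint sQ'S Q'_xt.
  rewrite Q'_min => /(_ (leqnn _)); rewrite setIYl Q_cut set0Y => D_cut.
  by rewrite D_cut cards0 in crossD.
have := odd_weightY l Q D; rewrite (negPf (even_weight sDS evenD)) Q_min addbF.
have := weight_swap D_swap; rewrite Q_min; lia.
Qed.

Lemma odd_join_crossings A : odd_vertices A = T -> odd #|A :&: cut X|.
Proof.
move/joinY/(odd_card_cut_join X).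
by rewrite setIYl Q_cut setY0 (negPf xX) component_refl.
Qed.

Lemma join_crossings_le k A :
    (forall B, B \subset S -> odd_vertices B = T -> k <= weight l B) ->
    A \subset S -> odd_vertices A = T ->
  k + #|A :&: cut X| <= weight l A + 1.
Proof.
move=> k_min; have [n] := ubnP #|A :&: cut X|; elim: n A => // n IH A.
rewrite ltnS => An sAS oddA; have [|crossA] := leqP #|A :&: cut X| 1.
  by have := k_min A sAS oddA; lia.
have [B [sBS oddB crossB wBA]] := join_exchange sAS oddA crossA.
by have := IH B _ sBS oddB; lia.
Qed.

End Exchange.
End NearestJoin.

Lemma near_join_lt_min_join l S J : min_join l S J -> 0 < weight l J ->
  exists2 A, near_join S (odd_vertices J) A & weight l A < weight l J.
Proof.
move=> [sJS _]; rewrite lt0n sum_nat_eq0 => /forallPn/=[j].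
rewrite negb_imply -lt0n => /andP[Jj l_j].
exists (J :+: [set j]).
  apply: (@near_joinI _ _ _ (ends j).1 (ends j).2).
    by rewrite subYset ?sub1set // (subsetP sJS).
  by rewrite odd_verticesY odd_vertices1 setYA.
have := weightY l J [set j]; rewrite (setIidPr _) ?sub1set // weight_set1; lia.
Qed.

Lemma exists_tight_cut l S J Y : {in S, forall e, odd (l e) = (e \in cut Y)} ->
    min_join l S J -> 0 < weight l J ->
  exists X, [/\ {in S :&: cut X, forall e, 0 < l e}, #|J :&: cut X| = 1 &
    min_join (fun e => l e - (e \in cut X)) S J].
Proof.
move=> odd_length minJ wJ; have [sJS minJw] := minJ.
have [R nearR wR] := near_join_lt_min_join minJ wJ.
have [Q nearQ Q_min] := arg_minnP (weight l) nearR.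
have [sQS /existsP[x /existsP[t /eqP Q_xt]]] := andP nearQ.
have wQJ : weight l Q < weight l J := leq_ltn_trans (Q_min _ nearR) wR.
set X := component (null_edges l S) t.
have xX : x \notin X.
  rewrite inE; apply/negP=> /connect_join[Z sZ Z_tx].
  have := minJw (Q :+: Z); rewrite subYset //; last first.
    exact: subset_trans sZ (null_edges_sub l S).
  rewrite odd_verticesY Q_xt Z_tx setYKA setYK.
  rewrite (weightY_null _ (null_edgesP sZ)) => /(_ isT erefl).
  by rewrite leqNgt wQJ.
have cutX_gt0 : {in S :&: cut X, forall e, 0 < l e}.
  by move=> e /setIP[]; apply: null_component_cut_gt0.
have crossings_le A : A \subset S -> odd_vertices A = odd_vertices J ->
    weight l J + #|A :&: cut X| <= weight l A + 1.
  exact: (join_crossings_le Q_min odd_length sQS Q_xt erefl xX minJw).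
have crossJ : #|J :&: cut X| = 1.
  have := odd_join_crossings Q_min sQS Q_xt erefl xX (erefl (odd_vertices J)).
  have := crossings_le J sJS erefl; rewrite -/X.
  by case: #|_| => [|[|]] //; lia.
exists X; split=> //; split=> // A sAS oddA.
have weight_dec B : B \subset S ->
    weight l B = weight (fun e => l e - (e \in cut X)) B + #|B :&: cut X|.
  by move=> sBS; apply/weight_sub1/(sub_in1 _ cutX_gt0)/subsetP/setSI.
have := crossings_le A sAS oddA.
by rewrite (weight_dec A) // (weight_dec J) // crossJ; lia.
Qed.

(* Subdividing each edge e into l e edges would give a bipartite graph; this is
   Seymour's packing theorem there, along the lines of Sebo's proof.  The cuts
   produced by [exists_tight_cut] are disjoint T-cuts, each containing a single
   edge of J. *)
Lemma min_join_weight_le k l S J Y :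
    {in S, forall e, odd (l e) = (e \in cut Y)} ->
    (forall X, odd #|J :&: cut X| -> k <= #|S :&: cut X|) -> min_join l S J ->
  k * weight l J <= weight l S.
Proof.
move=> + cutJ; have [n] := ubnP (weight l J).
elim: n => // n IH in l Y * => wJ odd_length minJ.
case: (posnP (weight l J)) => [-> | wJ0]; first by rewrite muln0.
have [X [cutX_gt0 crossJ minJ']] := exists_tight_cut odd_length minJ wJ0.
have cutX_gt0J : {in J :&: cut X, forall e, 0 < l e}.
  by apply: (sub_in1 _ cutX_gt0); apply/subsetP/setSI; case: minJ.
rewrite (weight_sub1 cutX_gt0) (weight_sub1 cutX_gt0J) crossJ in wJ *.
rewrite mulnDr muln1 leq_add ?cutJ ?crossJ //.
apply: IH (Y :+: X) _ _ minJ' => [|e Se]; first by rewrite addn1 in wJ.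
have := cutX_gt0 e; rewrite cutY in_setY -odd_length // in_setI Se /=.
case: (e \in cut X) => [/(_ isT) l_e | _]; last by rewrite subn0 addbF.
by rewrite oddB // addbT.
Qed.

End MinimumJoins.

Section EvenSets.
Variable G : multigraph.
Implicit Types (e : edge G) (v : vert G) (A B C F S : {set edge G}).
Implicit Types (X : {set vert G}).

(* An edge of S lies in an even subset of S if and only if it is not a cut-edge
   of the spanning subgraph with edge set S. *)
Definition bridgeless S := forall e, e \in S ->
  exists C : {set edge G}, [/\ C \subset S, odd_vertices C = set0 & e \in C].

Definition max_even_set S C := [/\ C \subset S, odd_vertices C = set0 &
  forall A, A \subset S -> odd_vertices A = set0 -> #|A| <= #|C|].

Lemma exists_max_even_set S : exists C, max_even_set S C.
Proof.
pose evenb A := (A \subset S) && (odd_vertices A == set0).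
have even0 : evenb set0 by rewrite /evenb sub0set odd_vertices0 eqxx.
have [C /andP[sCS /eqP evenC] maxC] :=
  arg_maxnP (fun A => #|pred_of_set A|) even0.
by exists C; split=> // A sAS evenA; apply: maxC; rewrite /evenb sAS evenA eqxx.
Qed.

Definition covered C : {set vert G} := [set v | 0 < deg_in C v].

Lemma bridgeless_cut S X : bridgeless S -> #|S :&: cut X| != 1.
Proof.
move=> bridgelessS; apply/negP=> /cards1P[e SXe].
have /setIP[Se Xe] : e \in S :&: cut X by rewrite SXe inE.
have [C [sCS /(even_card_cut X) + Ce]] := bridgelessS e Se.
suff -> : C :&: cut X = [set e] by rewrite cards1.
by apply/eqP; rewrite eqEsubset -SXe setSI //= SXe sub1set inE Ce.
Qed.

Lemma max_even_set_ge S C : bridgeless S -> max_even_set S C ->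
  2 * #|S| <= 3 * #|C|.
Proof.
move=> bridgelessS [sCS evenC maxC]; pose J := S :\: C.
have JE : J = S :+: C by rewrite setY_sub.
have oddJ : odd_vertices J = odd_vertices S.
  by rewrite JE odd_verticesY evenC setY0.
have card_weight2 A : weight (fun=> 2) A = 2 * #|A|.
  by rewrite /weight sum_nat_const mulnC.
have minJ : min_join (fun=> 2) S J.
  split=> [|A sAS oddA]; first exact: subsetDl.
  have := maxC (S :\: A); rewrite subsetDl -setY_sub //.
  rewrite odd_verticesY oddA oddJ setYv.
  rewrite !card_weight2 setY_sub // => /(_ isT erefl).
  have := cardsID A S; have := cardsID C S; rewrite !(setIidPr _) // -/J; lia.
have cutJ X : odd #|J :&: cut X| -> 3 <= #|S :&: cut X|.
  have := odd_cardsIY S C (cut X).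
  rewrite -JE (negPf (even_card_cut X evenC)) addbF => ->.
  by have := bridgeless_cut X bridgelessS; case: #|_| => [|[|[|]]].
have odd_length : {in S, forall e, odd 2 = (e \in cut set0)}.
  by move=> e _; rewrite !inE.
have := min_join_weight_le odd_length cutJ minJ; rewrite !card_weight2.
by have := cardsID C S; rewrite (setIidPr _) // -/J; lia.
Qed.

Lemma deg_inside A X v : A :&: cut X = set0 ->
  deg_in (inside A X) v = if v \in X then deg_in A v else 0.
Proof.
move=> A_cut.
have A_ends e : e \in A -> ((ends e).1 \in X) = ((ends e).2 \in X).
  move=> Ae; have := in_set0 e; rewrite -A_cut in_setI Ae in_set /=.
  by do 2 case: (_ \in X).
have end_neq a b : a \in X -> b \notin X -> a == b = false.
  by move=> aX bX; apply: contraNF bX => /eqP<-.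
rewrite /deg_in big_mkcond [X in if _ then X else _]big_mkcond.
case: (boolP (v \in X)) => vX; last apply: big1 => e _; rewrite ?inE.
  apply: eq_bigr => e _; rewrite inE; case: (boolP (e \in A)) => //= Ae.
  rewrite A_ends // andbb; case: (boolP (_ \in X)) => // e2X.
  by rewrite ![_ == v]eq_sym !end_neq // A_ends.
case: (boolP (e \in A)) => //= Ae; rewrite A_ends // andbb.
by case: (boolP (_ \in X)) => // e2X; rewrite !end_neq // A_ends.
Qed.

Lemma even_inside A X : A :&: cut X = set0 -> odd_vertices A = set0 ->
  odd_vertices (inside A X) = set0.
Proof.
move=> A_cut /setP evenA; apply/setP=> v; have := evenA v.
by rewrite !inE deg_inside //; case: ifP.
Qed.

Lemma insideS A B X : A \subset B -> inside A X \subset inside B X.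
Proof.
by move=> /subsetP sAB; apply/subsetP=> e; rewrite !inE => /andP[/sAB-> ->].
Qed.

Lemma inside_sub A X : inside A X \subset A.
Proof. by apply/subsetP=> e; rewrite inE => /andP[]. Qed.

Lemma bridgeless_inside S X : bridgeless S -> S :&: cut X = set0 ->
  bridgeless (inside S X).
Proof.
move=> bridgelessS S_cut e.
rewrite inE => /andP[/bridgelessS[C [sCS evenC Ce]] eX].
exists (inside C X); split; [exact: insideS | | by rewrite inE Ce].
exact: even_inside (sub_setI0 sCS S_cut) evenC.
Qed.

Lemma max_even_set_inside S C X : max_even_set S C -> S :&: cut X = set0 ->
  max_even_set (inside S X) (inside C X).
Proof.
move=> [sCS evenC maxC] S_cut; have sCX := inside_sub C X.
have evenCX := even_inside (sub_setI0 sCS S_cut) evenC.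
split=> // [|A sAX evenA]; first exact: insideS.
have disjA : (C :\: inside C X) :&: A = set0.
  apply/setP=> e; rewrite in_set0 !inE; apply/negP=> /andP[/andP[+ Ce] Ae].
  by rewrite Ce /=; have := subsetP sAX e Ae; rewrite inE => /andP[_ ->].
have sBS : C :+: inside C X :+: A \subset S.
  by rewrite !subYset ?(subset_trans sCX) ?(subset_trans sAX) ?inside_sub.
have := maxC _ sBS.
rewrite !odd_verticesY evenC evenCX evenA !setY0 => /(_ erefl).
have := cardsY (C :\: inside C X) A; rewrite disjA cards0 (setY_sub sCX).
by have := cardsID (inside C X) C; rewrite (setIidPr sCX); lia.
Qed.

End EvenSets.

Local Notation croot F := (fingraph.root (adj_in F)).

Section CutEdges.
Variable G : multigraph.
Implicit Types (e : edge G) (u v r : vert G) (A B F : {set edge G}).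
Implicit Types (X : {set vert G}).

Definition component_roots F : {set vert G} := [set r | r \in roots (adj_in F)].

Lemma ncompE F : ncomp F = #|component_roots F|.
Proof.
by rewrite /ncomp /n_comp_mem; apply: eq_card => v; rewrite !inE andbT.
Qed.

Lemma mem_component_roots F v : croot F v \in component_roots F.
Proof. by rewrite inE; apply/roots_root/connect_adj_sym. Qed.

Lemma croot_eq F u v : (croot F u == croot F v) = connect (adj_in F) u v.
Proof. exact/root_connect/connect_adj_sym. Qed.

Lemma sum_components F (f : vert G -> nat) :
  \sum_v f v = \sum_(r in component_roots F) \sum_(v in component F r) f v.
Proof.
rewrite (partition_big (croot F) (mem (component_roots F))) /=; last first.
  by move=> v _; apply: mem_component_roots.
apply: eq_bigr => r; rewrite inE => /eqP root_r; apply: eq_bigl => v.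
by rewrite inE -croot_eq root_r eq_sym.
Qed.

Lemma card_components F X :
  #|X| = \sum_(r in component_roots F) #|component F r :&: X|.
Proof.
rewrite -sum1_card big_mkcond (sum_components F); apply: eq_bigr => r _.
by rewrite -big_mkcondr -sum1_card; apply: eq_bigl => v; rewrite in_setI.
Qed.

Lemma ncomp_ltn F A u v : F \subset A -> connect (adj_in A) u v ->
  ~~ connect (adj_in F) u v -> ncomp A < ncomp F.
Proof.
move=> sFA Auv Fuv; rewrite !ncompE.
have root_inj : {in component_roots A &, injective (croot F)}.
  move=> r s; rewrite !inE => /eqP {2}<- /eqP {2}<- /eqP.
  by rewrite croot_eq => /(connect_adjS sFA); rewrite -croot_eq => /eqP.
pose w := if croot F (croot A u) == croot F u then croot F v else croot F u.
have w_root : w \in component_roots F.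
  by rewrite /w; case: ifP => _; apply: mem_component_roots.
rewrite -(card_in_imset root_inj) (cardsD1 w (component_roots F)) w_root ltnS.
apply/subset_leq_card/subsetP=> _ /imsetP[r root_r ->].
rewrite in_setD1 mem_component_roots andbT.
have root_neq z : connect (adj_in A) u z -> croot F (croot A u) != croot F z ->
    croot F r != croot F z.
  move=> Auz; apply: contraNneq => rz; rewrite -rz.
  move: Auz root_r; rewrite inE -croot_eq => /eqP-> /eqP<-.
  move/eqP: rz; rewrite croot_eq => /(connect_adjS sFA).
  by rewrite -croot_eq => /eqP->.
rewrite /w; case: ifPn => [/eqP uu|uu]; apply: root_neq => //.
by rewrite uu croot_eq.
Qed.

Lemma cut_edgeE e :
  cut_edge e = ~~ connect (adj_in [set~ e]) (ends e).1 (ends e).2.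
Proof.
apply/idP/idP; last first.
  by apply: ncomp_ltn; rewrite ?subsetT //; apply/connect1/adj_in_ends.
apply: contraL => e12; rewrite /cut_edge -leqNgt leq_eqVlt; apply/orP; left.
apply/eqP/eq_n_comp => u v; apply/idP/idP.
  exact: connect_adjS (subsetT _) _ _.
apply: connect_sub => x y /existsP[f /andP[_ xy]].
have [fe|nfe] := eqVneq f e; last first.
  by apply/connect1/existsP; exists f; rewrite !inE nfe.
by move: xy e12; rewrite fe => /orP[]/eqP->//=; rewrite connect_adj_sym.
Qed.

Lemma cut_edgeP e : reflect (exists X, cut X = [set e]) (cut_edge e).
Proof.
rewrite cut_edgeE; apply: (iffP idP) => [e12 | [X Xe]].
  exists (component [set~ e] (ends e).1); apply/setP=> f; rewrite in_set1.
  have [->|nfe] := eqVneq f e; first by rewrite !inE connect0 (negPf e12).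
  by apply/negbTE/notin_cut_component; rewrite !inE.
have : e \in cut X by rewrite Xe inE.
rewrite inE; apply: contraL => /(@connect_cut0 _ _ X)->; first by rewrite addbb.
by rewrite Xe setIC; apply/eqP; rewrite setI_eq0 disjoints_subset setCK.
Qed.

Lemma ncomp_setC_cut_edges B : {in B, forall e, cut_edge e} ->
  ncomp [set: edge G] + #|B| <= ncomp (~: B).
Proof.
have [n] := ubnP #|B|; elim: n B => // n IH B Bn cutB.
have [->|[b Bb]] := set_0Vmem B; first by rewrite cards0 addn0 setC0.
rewrite (cardsD1 b) Bb in Bn *; rewrite addnCA add1n.
apply: leq_ltn_trans (IH _ Bn _) _ => [f /setD1P[_ /cutB] //|].
apply: (@ncomp_ltn _ _ (ends b).1 (ends b).2); first by rewrite setCS subD1set.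
  by apply/connect1/adj_in_ends; rewrite !inE eqxx.
have := cutB _ Bb; rewrite cut_edgeE; apply: contra; apply: connect_adjS.
by apply/subsetP=> f; rewrite !inE; apply: contraNneq => ->.
Qed.

Definition noncut : {set edge G} := [set e | ~~ cut_edge e].

Lemma card_noncut : num_cut_edges G + #|noncut| = #|edge G|.
Proof.
rewrite -(cardsC [set e | cut_edge e]); congr (_ + _).
by apply: eq_card => e; rewrite !inE.
Qed.

Lemma ncomp_noncut : ncomp [set: edge G] + num_cut_edges G <= ncomp noncut.
Proof.
have -> : noncut = ~: [set e | cut_edge e] by apply/setP=> e; rewrite !inE.
by apply: ncomp_setC_cut_edges => e; rewrite inE.
Qed.

Lemma even_sub_noncut A : odd_vertices A = set0 -> A \subset noncut.
Proof.
move=> evenA; apply/subsetP=> e Ae; rewrite inE; apply/cut_edgeP=> -[X Xe].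
by have := even_card_cut X evenA; rewrite Xe (setIidPr _) ?sub1set ?cards1.
Qed.

Lemma bridgeless_noncut : bridgeless noncut.
Proof.
move=> e; rewrite inE cut_edgeE negbK => /connect_join[P sP joinP].
have evenC : odd_vertices (P :+: [set e]) = set0.
  by rewrite odd_verticesY joinP odd_vertices1 setYv.
exists (P :+: [set e]); split=> //; first exact: even_sub_noncut.
rewrite !inE eqxx addbT; apply/negP=> /(subsetP sP).
by rewrite !inE eqxx.
Qed.

Lemma cut_sub_saturated F X :
  {in X, forall v, deg_in setT v <= deg_in F v} -> cut X \subset F.
Proof.
move=> saturated; apply/subsetP=> e Xe; apply: contraT => Fe.
have [v vX ve] : exists2 v, v \in X & 0 < ((ends e).1 == v) + ((ends e).2 == v).
  move: Xe; rewrite inE; case: (boolP (_ \in X)) => /= [e1X _|_ e2X].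
    by exists (ends e).1; rewrite ?eqxx.
  by exists (ends e).2; rewrite ?eqxx ?addn1.
have := saturated v vX; rewrite [X in X <= _](big_setID F) /= setTI setTD.
by rewrite -/(deg_in F v) [Y in _ + Y](bigD1 e) ?inE //=; lia.
Qed.

(* The subtraction does not truncate when the maximum degree is at most 3. *)
Definition deficit_in F X : nat := \sum_(v in X) (3 - deg_in F v).

End CutEdges.

Section Subcubic.
Variable G : multigraph.
Hypothesis subcubic : max_degree G <= 3.
Implicit Types (v r : vert G) (C F : {set edge G}) (X : {set vert G}).

Lemma deg_in_le3 F v : deg_in F v <= 3.
Proof.
by apply: leq_trans (leq_trans (leq_bigmax v) subcubic); apply/deg_inS/subsetT.
Qed.

Lemma deficit_inD F X : deficit_in F X + \sum_(v in X) deg_in F v = 3 * #|X|.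
Proof.
rewrite -big_split mulnC -sum_nat_const; apply: eq_bigr => v _ /=.
by rewrite subnK ?deg_in_le3.
Qed.

Lemma deficit_in0_component F r : deficit_in F (component F r) = 0 ->
  component F r = component setT r.
Proof.
set X := component F r => /eqP; rewrite sum_nat_eq0 => /forall_inP/= no_deficit.
have cutX : [set: edge G] :&: cut X = set0.
  rewrite setTI -(setIidPl (@cut_sub_saturated _ F X _)) => [|v /no_deficit].
    by rewrite setIC component_cut.
  by rewrite subn_eq0; apply: leq_trans (deg_in_le3 _ _).
apply/setP=> u; apply/idP/idP; rewrite ![u \in _]inE.
  exact: connect_adjS (subsetT _) _ _.
by move/(connect_cut0 cutX); rewrite component_refl inE => <-.
Qed.

Let F := noncut G.
Let deficient_roots :=
  [set r in component_roots F | 0 < deficit_in F (component F r)].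

Lemma num_cut_edges_lt v : 0 < deficit_in F (component F v) ->
  num_cut_edges G < #|deficient_roots|.
Proof.
move=> deficient_v; set Z := component_roots F :\: deficient_roots.
have mem_Z r : r \in Z ->
    [/\ croot F r = r, component F r = component setT r &
        v \notin component F r].
  rewrite in_setD [_ \in deficient_roots]in_set => /andP[+ root_r].
  rewrite root_r /= -eqn0Ngt => /eqP no_deficit.
  split; first by move: root_r; rewrite inE => /eqP.
    exact: deficit_in0_component.
  by apply: contraTN deficient_v => /eq_component->; rewrite no_deficit.
have croot_inj : {in Z &, injective (croot setT)}.
  move=> r s /mem_Z[root_r rT _] /mem_Z[root_s _ _] /eqP.
  rewrite croot_eq => rs.
  have : s \in component F r by rewrite rT inE.
  by rewrite inE -croot_eq root_r root_s => /eqP.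
have ltZ : #|Z| < ncomp [set: edge G].
  rewrite ncompE -(card_in_imset croot_inj).
  rewrite (cardsD1 (croot setT v) (component_roots _)) mem_component_roots ltnS.
  apply/subset_leq_card/subsetP=> _ /imsetP[r Zr ->].
  rewrite in_setD1 mem_component_roots andbT croot_eq.
  by have [_ rT] := mem_Z r Zr; rewrite rT inE.
have sub_roots : deficient_roots \subset component_roots F.
  by apply/subsetP=> r; rewrite inE => /andP[].
have := cardsID deficient_roots (component_roots F).
rewrite (setIidPr sub_roots).
by have := ncomp_noncut G; rewrite (ncompE (noncut G)) -/F -/Z; lia.
Qed.

Lemma deg_in_covered C v : odd_vertices C = set0 ->
  deg_in C v = 2 * (v \in covered C).
Proof.
move=> /setP/(_ v); rewrite !inE; have := deg_in_le3 C v.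
by case: (deg_in C v) => [|[|[|[|]]]].
Qed.

Lemma card_covered_le_f2 C : odd_vertices C = set0 -> #|covered C| <= f2 G.
Proof.
move=> evenC.
apply: (@leq_bigmax_cond _ (fun H => subgraph H && two_regular H)
          (fun H : {set vert G} * {set edge G} => #|H.1|) (covered C, C)).
apply/andP; split; last first.
  by apply/forall_inP => v /= vC; rewrite deg_in_covered ?vC.
apply/forall_inP => e /= Ce; rewrite !inE !/(deg_in C _) !(bigD1 e Ce) /= !eqxx.
by rewrite !addn_gt0 /= orbT.
Qed.

Lemma uncovered_component_le C r : max_even_set F C ->
  3 * #|component F r :\: covered C| <= deficit_in F (component F r).
Proof.
set X := component F r => maxC; have [sCF evenC _] := maxC.
have F_cut : F :&: cut X = set0 by apply: component_cut.
have := max_even_set_ge (bridgeless_inside (@bridgeless_noncut G) F_cut)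
          (max_even_set_inside maxC F_cut).
have := deficit_inD F X; rewrite sum_deg_in F_cut cards0.
have := sum_deg_in C X; rewrite (sub_setI0 sCF F_cut) cards0.
rewrite (eq_bigr _ (fun v _ => deg_in_covered v evenC)) -big_distrr /=.
have -> : \sum_(v in X) (v \in covered C) = #|X :&: covered C|.
  by rewrite -big_mkcondr -sum1_card; apply: eq_bigl => v; rewrite in_setI.
by rewrite -/F; have := cardsID (covered C) X; lia.
Qed.

Lemma num_uncovered_lt C : max_even_set F C -> covered C != setT ->
  2 * #|~: covered C| + num_cut_edges G < deficit_in F setT.
Proof.
move=> maxC; rewrite -subTset => /subsetPn[v _ v_uncovered].
have deficient_v : 0 < deficit_in F (component F v).
  apply: leq_trans (uncovered_component_le v maxC); rewrite muln_gt0 /=.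
  by apply/card_gt0P; exists v; rewrite in_setD component_refl v_uncovered.
have -> : deficit_in F setT =
    \sum_(r in component_roots F) deficit_in F (component F r).
  by rewrite -sum_components; apply: eq_bigl => u; rewrite inE.
have card_deficient : #|deficient_roots| =
    \sum_(r in component_roots F) (0 < deficit_in F (component F r)).
  by rewrite -big_mkcondr sum1dep_card.
apply: leq_trans (_ : 2 * #|~: covered C| + #|deficient_roots| <= _).
  by rewrite ltn_add2l (num_cut_edges_lt deficient_v).
rewrite (card_components F) card_deficient big_distrr -big_split.
apply: leq_sum => r _ /=; rewrite -setDE.
by have := uncovered_component_le r maxC; lia.
Qed.

Lemma double_f2_gt : f2 G < #|vert G| ->
  2 * #|edge G| < 2 * f2 G + #|vert G| + num_cut_edges G.
Proof.
have [C maxC] := exists_max_even_set F; have [_ evenC _] := maxC.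
have := card_covered_le_f2 evenC; have := cardsC (covered C).
have [-> | /(num_uncovered_lt maxC)] := eqVneq (covered C) setT.
  by rewrite cardsT leqNgt => _ /negPf->.
have := deficit_inD F setT; rewrite sum_deg_in.
have -> : cut [set: vert G] = set0 by apply/setP=> e; rewrite !inE.
have -> : inside F setT = F by apply/setP=> e; rewrite !inE !andbT.
have := card_noncut G; rewrite -/F setI0 cards0 cardsT; lia.
Qed.

Lemma f2_lower_bound : ((f2 G)%:R >= #|vert G|%:R
  - Num.max 0 (((deficit G)%:~R + (num_cut_edges G)%:R - 1) / 2) :> rat)%R.
Proof.
rewrite lerBlDr; have [n_le | /double_f2_gt] := leqP #|vert G| (f2 G).
  by rewrite (le_trans (y := (f2 G)%:R)%R) ?ler_nat // lerDl le_max lexx.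
rewrite -(ler_nat rat) -[X in (X%:R <= _)%R]addn1 !natrD.
have -> : ((deficit G)%:~R = 3 * #|vert G|%:R - 2 * #|edge G|%:R :> rat)%R.
  by rewrite intrB !intrM -!pmulrn.
set x := ((_ - 1) / 2)%R.
have : (x <= Num.max 0 x)%R by rewrite le_max lexx orbT.
by move: (Num.max 0%R x); rewrite /x => m; lra.
Qed.

End Subcubic.

Lemma f2_le_covered_noncut (G : multigraph) : f2 G <= #|covered (noncut G)|.
Proof.
apply/bigmax_leqP => -[X A] /andP[/forall_inP/= sub_XA /forall_inP/= reg_XA].
have evenA : odd_vertices A = set0.
  apply/setP=> v; rewrite !inE.
  case: (boolP (v \in X)) => [/reg_XA/eqP-> // | vX].
  have end_neq u : u \in X -> (u == v) = false.
    by move=> uX; apply: contraNF vX => /eqP<-.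
  by rewrite /deg_in big1 // => e /sub_XA/andP[e1 e2]; rewrite !end_neq.
apply/subset_leq_card/subsetP=> v /reg_XA/eqP deg_v; rewrite inE.
by rewrite (leq_trans _ (deg_inS v (even_sub_noncut evenA))) ?deg_v.
Qed.

(* Tooth i of the comb joins (i, false) to (i, true); a loop is attached to
   (i, true), and the vertices (i, false) form a path. *)
Definition looped_comb (N : nat) : multigraph :=
  @Multigraph ('I_N.+1 * bool)%type ('I_N.+1 * bool + 'I_N)%type
    (fun e => match e with
              | inl p => (p, (p.1, true))
              | inr i => ((widen_ord (leqnSn N) i, false), (lift ord0 i, false))
              end).

Lemma sum_inj_eq_le1 (I : finType) (T : eqType) (f : I -> T) y :
  injective f -> \sum_i (f i == y) <= 1.
Proof.
move=> f_inj; rewrite -big_mkcond sum1dep_card; apply/card_le1_eqP => i j.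
by rewrite !inE => /eqP<- /eqP/f_inj.
Qed.

Section LoopedComb.
Variable N : nat.
Local Notation G := (looped_comb N).

Lemma card_vert_looped_comb : #|vert G| = 2 * N.+1.
Proof. by rewrite card_prod card_ord card_bool mulnC. Qed.

Lemma card_edge_looped_comb : #|edge G| = 3 * N + 2.
Proof. by rewrite card_sum card_prod card_bool !card_ord; lia. Qed.

Lemma max_degree_looped_comb : max_degree G <= 3.
Proof.
apply/bigmax_leqP => -[k b] _; rewrite /deg_in (eq_bigl _ _ (@in_setT _)).
rewrite big_sumType /= !big_split /=.
have sum_row (m : nat) (f : 'I_m -> 'I_N.+1) c : injective f ->
    \sum_i ((f i, c) == (k, b)) <= (c == b).
  move=> f_inj; case: eqP => [->|/eqP/negPf cb]; last first.
    by rewrite big1 // => i _; rewrite xpair_eqE cb andbF.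
  by apply: (sum_inj_eq_le1 _ (f := fun i => (f i, b))) => i j [/f_inj].
have tips : \sum_(p : 'I_N.+1 * bool) ((p.1, true) == (k, b)) <= 2 * b.
  rewrite -(pair_bigA _ (fun i (_ : bool) => ((i, true) == (k, b) : nat))) /=.
  under eq_bigr => i _ do rewrite sum_nat_const card_bool.
  rewrite -big_distrr leq_pmul2l //=.
  by have := sum_row _ id true (@inj_id _); case: (b).
have widen_inj : injective (widen_ord (leqnSn N)) by move=> i j [/val_inj].
have verts := sum_inj_eq_le1 (k, b) (@inj_id _).
have path_r := sum_row _ _ false widen_inj.
have path_l := sum_row _ _ false (@lift_inj _ ord0).
have := leq_add (leq_add verts tips) (leq_add path_r path_l).
by move/leq_trans; apply; case: (b).
Qed.

Lemma cut_edge_looped_comb (e : edge G) :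
  cut_edge e = if e is inl (_, true) then false else true.
Proof.
case: e => [[i []]|i]; apply/cut_edgeP.
- by case=> X /setP/(_ (inl (i, true))); rewrite !inE eqxx /= addbb.
- exists [set (i, true)]; apply/setP=> -[[j b]|j];
    rewrite !inE /= !xpair_eqE ?andbF //.
  rewrite -[RHS]/((j, b) == (i, false)) xpair_eqE.
  by case: b; rewrite ?andbT ?andbF ?addbb.
exists [set v : vert G | v.1 <= i]; apply/setP=> -[[j b]|j];
  rewrite !inE ?addbb //=.
have -> : (inr j == inr i :> edge G) = (j == i :> nat) by [].
by rewrite /bump /=; lia.
Qed.

Lemma card_noncut_looped_comb : #|noncut G| = N.+1.
Proof.
have -> : noncut G = [set (inl (i, true) : edge G) | i in 'I_N.+1].
  apply/setP=> e; rewrite inE cut_edge_looped_comb; apply/esym/imsetP.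
  case: e => [[i []]|i] /=; [by exists i | by case | by case].
by rewrite card_imset ?card_ord // => i j [].
Qed.

Lemma num_cut_edges_looped_comb : num_cut_edges G = (2 * N).+1.
Proof.
have := card_noncut G; rewrite card_noncut_looped_comb card_edge_looped_comb.
by lia.
Qed.

Lemma deficit_looped_comb : deficit G = 2.
Proof.
by rewrite /deficit card_vert_looped_comb card_edge_looped_comb; lia.
Qed.

Lemma f2_looped_comb : f2 G = N.+1.
Proof.
apply/eqP; rewrite eqn_leq; apply/andP; split; last first.
  rewrite leqNgt; apply/negP=> f2_lt.
  have := double_f2_gt max_degree_looped_comb.
  rewrite num_cut_edges_looped_comb.
  by rewrite card_vert_looped_comb card_edge_looped_comb; lia.
apply: leq_trans (f2_le_covered_noncut G) _.
pose tips := [set ((i, true) : vert G) | i in 'I_N.+1].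
apply: leq_trans (_ : #|tips| <= _); last first.
  by rewrite (leq_trans (leq_imset_card _ _)) ?card_ord.
apply/subset_leq_card/subsetP=> -[i []]; first by rewrite imset_f.
rewrite inE /deg_in big1 // => -[[j []]|j];
  rewrite inE cut_edge_looped_comb //= => _.
by rewrite !xpair_eqE !andbF.
Qed.

End LoopedComb.

Local Open Scope ring_scope.

Theorem theorem1p3 :
  (forall (G : multigraph) (n c : nat) (d : int),
     (max_degree G <= 3)%N ->
     #|vert G| = n ->
     num_cut_edges G = c ->
     deficit G = d ->
     (f2 G)%:R >= n%:R - Num.max 0 ((d%:~R + c%:R - 1) / 2) :> rat)
  /\
  (forall N : nat, exists (G : multigraph) (n c : nat) (d : int),
     (N <= n)%N /\
     (max_degree G <= 3)%N /\
     #|vert G| = n /\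
     num_cut_edges G = c /\
     deficit G = d /\
     (f2 G)%:R = n%:R - Num.max 0 ((d%:~R + c%:R - 1) / 2) :> rat).
Proof.
split=> [G _ _ _ subcubic <- <- <- | N]; first exact: f2_lower_bound.
exists (looped_comb N), (2 * N.+1)%N, (2 * N).+1, 2; do 5?split=> //.
- by lia.
- exact: max_degree_looped_comb.
- exact: card_vert_looped_comb.
- exact: num_cut_edges_looped_comb.
- exact: deficit_looped_comb.
rewrite f2_looped_comb natrM -(natr1 N) -(natr1 (2 * N)) natrM max_r;
  have := ler0n rat N; lra.
Qed.
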